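(* Let $\{Q\}$ be a system of quasiseparable polynomials, $\deg Q_k=k$, satisfying $$\begin{bmatrix}G_k(x)\\Q_k(x)\end{bmatrix}=\begin{bmatrix}\alpha_k&\beta_k\\ \gamma_k&\delta_kx+\theta_k\end{bmatrix}\begin{bmatrix}G_{k-1}(x)\\Q_{k-1}(x)\end{bmatrix},\qquad k=1,\dots,n,$$ with auxiliary polynomials $G_k$, $G_0=0$, where $\beta_k\neq0$ for all $k$. Then the system of generalized associated polynomials $\widehat Q=\{\widehat Q_0,\dots,\widehat Q_{n-1}\}$ satisfies $$\widehat Q_1(x)=(\widehat\alpha_1x-\widehat\delta_1)\widehat Q_0(x),$$ $$\widehat Q_k(x)=(\widehat\alpha_kx-\widehat\delta_k)\widehat Q_{k-1}(x)-(\widehat\beta_kx+\widehat\gamma_k)\widehat Q_{k-2}(x),\qquad k=2,\dots,n-1,$$ with $$\widehat\alpha_k=\delta_{n-k},\qquad\widehat\beta_k=\delta_{n-k}\,\alpha_{n-k+2}\,\frac{\beta_{n-k+1}}{\beta_{n-k+2}},$$ $$\widehat\delta_k=-\frac{\delta_{n-k}}{\delta_{n-k+1}}\left(\theta_{n-k+1}+\alpha_{n-k+2}\frac{\beta_{n-k+1}}{\beta_{n-k+2}}\right),$$ $$\widehat\gamma_k=\frac{\delta_{n-k}}{\delta_{n-k+2}}\cdot\frac{\beta_{n-k+1}}{\beta_{n-k+2}}\cdot\left(\theta_{n-k+2}\alpha_{n-k+2}-\beta_{n-k+2}\gamma_{n-k+2}\right),$$ where $\widehat\beta_k,\widehat\gamma_k$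 are needed only for $k\ge2$, and in $\widehat\delta_1$ the term containing the undefined coefficients of index $n+1$ is taken to be zero, i.e. $\widehat\delta_1=-\frac{\delta_{n-1}}{\delta_n}\theta_n$.
   Context: Generalized associated polynomials: let $Q_0,\dots,Q_n$ be complex polynomials with $\deg Q_k=k$, written as $Q_0(x)=\tau_0$ and $Q_k(x)=\tau_kx\,Q_{k-1}(x)-\sum_{j=0}^{k-1}a_{j,k}Q_j(x)$ for $k=1,\dots,n$ (so all $\tau_k\neq0$). The generalized associated (Horner) polynomials $\widehat Q_0,\dots,\widehat Q_{n-1}$ are defined by $$\widehat Q_0(x)=\widehat\tau_0,\qquad\widehat Q_k(x)=\widehat\tau_kx\,\widehat Q_{k-1}(x)-\sum_{j=0}^{k-1}\widehat a_{j,k}\widehat Q_j(x),\quad k=1,\dots,n-1,$$ $$\widehat\tau_k=\tau_{n-k}\ (k=0,\dots,n-1),\qquad\widehat a_{j,k}=\frac{\tau_{n-k}}{\tau_{n-j}}a_{n-k,n-j}\ (k=1,\dots,n-1,\ j=0,\dots,k-1).$$ *)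

(* Defs.v *)
From HB Require Import structures.
From mathcomp Require Import all_boot all_order all_algebra.
From mathcomp Require Import reals complex.

Set Implicit Arguments.
Unset Strict Implicit.
Unset Printing Implicit Defensive.

Import GRing.Theory.
Local Open Scope ring_scope.

Section QuasiseparableSystems.
Variable F : fieldType.
Implicit Types (Q G : nat -> {poly F}) (tau alpha beta gamma delta theta : nat -> F).
Implicit Types (a : nat -> nat -> F) (n k : nat).

(* Systems are sequences of which only the indices 0, ..., m are constrained. *)
Definition degree_graded m Q := forall k, (k <= m)%N -> size (Q k) = k.+1.

(* [a j k] is the coefficient a_{j,k}, for j < k. *)
Definition recurrent_form m tau a Q :=
  Q 0%N = (tau 0%N)%:P /\
  forall k, (0 < k <= m)%N ->
    Q k = tau k *: ('X * Q k.-1) - \sum_(j < k) a j k *: Q j.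

Definition assoc_tau n tau k := tau (n - k)%N.

Definition assoc_a n tau a j k :=
  tau (n - k)%N / tau (n - j)%N * a (n - k)%N (n - j)%N.

(* The last index is n - 1, so this is meant for 0 < n. *)
Definition generalized_associated n tau a Qhat :=
  recurrent_form n.-1 (assoc_tau n tau) (assoc_a n tau a) Qhat.

Definition qs_vector (g q : {poly F}) : 'cV[{poly F}]_(1 + 1) :=
  col_mx g%:M q%:M.

Definition qs_transfer alpha beta gamma delta theta k :
    'M[{poly F}]_(1 + 1, 1 + 1) :=
  block_mx (alpha k)%:P%:M (beta k)%:P%:M
           (gamma k)%:P%:M (delta k *: 'X + (theta k)%:P)%:M.

Definition quasiseparable_recurrence n alpha beta gamma delta theta G Q :=
  G 0%N = 0 /\
  forall k, (0 < k <= n)%N ->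
    qs_vector (G k) (Q k) =
      qs_transfer alpha beta gamma delta theta k
        *m qs_vector (G k.-1) (Q k.-1).

(* In these four formulas subtraction on nat is exact for 1 <= k < n. *)
Definition hat_alpha n delta k := delta (n - k)%N.

Definition hat_beta n alpha beta delta k :=
  delta (n - k)%N * alpha (n - k + 2)%N
    * (beta (n - k + 1)%N / beta (n - k + 2)%N).

(* For k = 1 the second summand would involve the undefined coefficients of
   index n + 1; it is zero by convention. *)
Definition hat_delta n alpha beta delta theta k :=
  - (delta (n - k)%N / delta (n - k + 1)%N)
    * (theta (n - k + 1)%N
       + (if k == 1%N then 0
          else alpha (n - k + 2)%N
                 * (beta (n - k + 1)%N / beta (n - k + 2)%N))).

Definition hat_gamma n alpha beta gamma delta theta k :=
  delta (n - k)%N / delta (n - k + 2)%N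
    * (beta (n - k + 1)%N / beta (n - k + 2)%N)
    * (theta (n - k + 2)%N * alpha (n - k + 2)%N
       - beta (n - k + 2)%N * gamma (n - k + 2)%N).

End QuasiseparableSystems.

(* Main.v *)
Require Import Defs.
From HB Require Import structures.
From mathcomp Require Import all_boot all_order all_algebra.
From mathcomp Require Import reals complex.
From mathcomp Require Import ring zify.

Set Implicit Arguments.
Unset Strict Implicit.
Unset Printing Implicit Defensive.

Import GRing.Theory.
Local Open Scope ring_scope.

(** Unrolling [G k = alpha k G (k-1) + beta k Q (k-1)] from [G 0 = 0] expresses
    the auxiliary polynomials in the basis [Q]:
      [G k = sum_(j < k) g k j Q j],
      [g k j = beta (j+1) alpha (j+2) ... alpha k].
    Substituting this in the second row of the quasiseparable recurrence gives
    a recurrence of the same form as the one with coefficients [tau] and [a].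
    A graded system is linearly independent, so the two have the same
    coefficients ([quasiseparable_generators]): [tau k = delta k],
    [a (k-1) k = - theta k], and [a j k = - gamma k * g (k-1) j] for
    [j < k - 1].

    The associated coefficients are those of [a] transposed about the
    antidiagonal and scaled by ratios of entries of [tau].  Hence, with [m = n - k], the recurrence for [Qhat k] is
      [Qhat k = (delta m X + delta m / delta (m+1) theta (m+1)) Qhat (k-1)
                + delta m T (k-1)],
    where the tail [T (k-1)] is a combination of [Qhat 0, ..., Qhat (k-2)]
    ([associated_step]).  The transposition turns the first index of [g],
    along which consecutive tails do not differ, into the summation index; the
    second index is the one that moves, and along it [g] satisfies
      [beta (j+2) g k j = alpha (j+2) beta (j+1) g k (j+1)].
    So two consecutive tails are proportional up to one new term
    ([hat_tailS]).  Dividing by [beta (m+2)] is what makes this a recurrence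
    for the tail, and this is where [beta] must not vanish.  Solving the
    previous step for the previous tail, which divides by [delta (m+1)], and
    substituting leaves only [Qhat (k-1)] and [Qhat (k-2)]; the collected
    coefficients are the stated ones.  For [k = 1] the tail is empty. *)

Section GradedSystems.
Variable F : fieldType.
Implicit Types (Q : nat -> {poly F}) (c d : nat -> F).

Lemma degree_gradedW m p Q :
  (p <= m)%N -> degree_graded m Q -> degree_graded p Q.
Proof. by move=> pm degQ k kp; apply: degQ; exact: leq_trans pm. Qed.

Lemma size_graded_sum m Q c :
  degree_graded m Q -> (size (\sum_(j < m.+1) c j *: Q j)%R <= m.+1)%N.
Proof.
move=> degQ; apply: leq_trans (size_sum _ _ _) _.
apply/bigmax_leqP => j _; apply: leq_trans (size_scale_leq _ _) _.
by rewrite degQ // -ltnS.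
Qed.

Lemma coef_graded_sum m Q c :
  degree_graded m Q -> (\sum_(j < m.+1) c j *: Q j : {poly F})`_m.+1 = 0.
Proof. by move=> degQ; apply/leq_sizeP/(leqnn m.+1); exact: size_graded_sum. Qed.

Lemma graded_top_coef_neq0 m Q : degree_graded m Q -> (Q m)`_m != 0.
Proof.
move=> degQ; have sQ := degQ m (leqnn m).
by have := lead_coef_eq0 (Q m); rewrite lead_coefE sQ /= -size_poly_eq0 sQ => ->.
Qed.

(** Only the last term reaches degree [m], so the top coefficients agree, and
    the rest follows by induction. *)
Lemma graded_sum_inj m Q c d :
  degree_graded m Q ->
  \sum_(j < m.+1) c j *: Q j = \sum_(j < m.+1) d j *: Q j ->
  forall j, (j <= m)%N -> c j = d j.
Proof.
elim: m => [|m IHm] degQ.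
  rewrite !big_ord1 => eq_cd j; rewrite leqn0 => /eqP ->.
  have /(congr1 (fun p : {poly F} => p`_0)) := eq_cd.
  by rewrite !coefZ => /(mulIf (graded_top_coef_neq0 degQ)).
have degQm : degree_graded m Q by apply: degree_gradedW degQ.
rewrite big_ord_recr [in RHS]big_ord_recr /= => eq_cd.
have top : c m.+1 = d m.+1.
  have /(congr1 (fun p : {poly F} => p`_m.+1)) := eq_cd.
  rewrite !coefD !(coef_graded_sum _ degQm) !add0r !coefZ.
  exact: (mulIf (graded_top_coef_neq0 degQ)).
move: eq_cd; rewrite top => /addIr eq_cd j.
by rewrite leq_eqVlt => /predU1P[->|]//; rewrite ltnS; exact: IHm.
Qed.

(** Multiplication by ['X] brings in degree [m.+1], which the sums do not
    reach: this isolates the leading scalar, and linear independence gives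
    the others. *)
Lemma graded_step_inj m Q (t u : F) c d :
  degree_graded m Q ->
  t *: ('X * Q m) - \sum_(j < m.+1) c j *: Q j =
  u *: ('X * Q m) - \sum_(j < m.+1) d j *: Q j ->
  t = u /\ forall j, (j <= m)%N -> c j = d j.
Proof.
move=> degQ eq_step.
have tu : t = u.
  have /(congr1 (fun p : {poly F} => p`_m.+1)) := eq_step.
  rewrite !coefB !(coef_graded_sum _ degQ) !subr0 !coefZ coefXM /=.
  exact: (mulIf (graded_top_coef_neq0 degQ)).
split=> //; apply: (graded_sum_inj degQ).
by move: eq_step; rewrite tu => /addrI/oppr_inj.
Qed.

End GradedSystems.

Section Quasiseparable.
Variable F : fieldType.
Variables (n : nat) (Q G : nat -> {poly F}).
Variables (alpha beta gamma delta theta : nat -> F).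
Hypothesis qsQ :
  quasiseparable_recurrence n alpha beta gamma delta theta G Q.

(** The matrix recurrence read off row by row, with polynomials in place of
    1 x 1 matrices. *)
Lemma quasiseparable_step k : (k < n)%N ->
  G k.+1 = alpha k.+1 *: G k + beta k.+1 *: Q k /\
  Q k.+1 = gamma k.+1 *: G k + (delta k.+1 *: 'X + (theta k.+1)%:P) * Q k.
Proof.
move=> kn; have [_ /(_ k.+1 kn)] := qsQ.
rewrite /qs_vector /qs_transfer mul_block_col /= -!scalar_mxM -!raddfD /=.
move=> /eq_col_mx[eqG eqQ]; rewrite -!mul_polyC.
move: (congr1 (fun M : 'M_1 => M 0 0) eqG) (congr1 (fun M : 'M_1 => M 0 0) eqQ).
by rewrite !mxE !mulr1n -!mul_polyC.
Qed.

(** The coefficient of [Q j] in [G k], for [j < k]. *)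
Definition aux_coef k j : F :=
  beta j.+1 * \prod_(j.+2 <= i < k.+1) alpha i.

Lemma aux_coef_diag k : aux_coef k.+1 k = beta k.+1.
Proof. by rewrite /aux_coef big_geq // mulr1. Qed.

Lemma aux_coefSl k j : (j < k)%N ->
  aux_coef k.+1 j = alpha k.+1 * aux_coef k j.
Proof.
by move=> jk; rewrite /aux_coef big_nat_recr //=; ring.
Qed.

(** Stated without division: raising the column index removes the first factor
    [alpha] from the product and shifts the index of [beta]. *)
Lemma aux_coefSr k j : (j.+1 < k)%N ->
  beta j.+2 * aux_coef k j = alpha j.+2 * beta j.+1 * aux_coef k j.+1.
Proof.
by move=> jk; rewrite /aux_coef big_ltn //; ring.
Qed.

Lemma auxiliary_expansion k : (k <= n)%N ->
  G k = \sum_(j < k) aux_coef k j *: Q j.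
Proof.
elim: k => [|k IHk] kn; first by rewrite big_ord0; case: qsQ.
have [-> _] := quasiseparable_step kn.
rewrite big_ord_recr /= aux_coef_diag IHk 1?ltnW // scaler_sumr.
congr (_ + _); apply: eq_bigr => j _.
by rewrite scalerA aux_coefSl.
Qed.

Variables (tau : nat -> F) (a : nat -> nat -> F).
Hypotheses (degQ : degree_graded n Q) (formQ : recurrent_form n tau a Q).

(** Both recurrences expand the same [Q k.+1] over a graded system, so their
    coefficients coincide. The entries of [a] have the low rank structure for
    which quasiseparable systems are named: row and column indices separate. *)
Lemma quasiseparable_generators k : (k < n)%N ->
  [/\ tau k.+1 = delta k.+1, a k k.+1 = - theta k.+1 &
      forall j, (j < k)%N -> a j k.+1 = - (gamma k.+1 * aux_coef k j)].
Proof.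
move=> kn; have [_ /(_ k.+1 kn)/= stepQ] := formQ.
(* The coefficients of the system in recurrent form that the expansion of [G]
   produces. *)
pose b j := - (if j == k then theta k.+1 else gamma k.+1 * aux_coef k j).
have stepG : Q k.+1 =
    delta k.+1 *: ('X * Q k) - \sum_(j < k.+1) b j *: Q j.
  have [_ ->] := quasiseparable_step kn.
  rewrite auxiliary_expansion 1?ltnW // big_ord_recr /= /b eqxx.
  rewrite mulrDl -scalerAl mul_polyC scaler_sumr opprD -sumrN scaleNr opprK.
  rewrite addrC -addrA; congr (_ + _); rewrite addrC; congr (_ + _).
  apply: eq_bigr => j _.
  by rewrite scalerA -scaleNr opprK ltn_eqF.
rewrite stepQ in stepG.
have degQk : degree_graded k Q by apply: degree_gradedW degQ; exact: ltnW.
have [tauE aE] := graded_step_inj (c := a^~ k.+1) degQk stepG.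
split=> // [|j jk]; first by rewrite aE // /b eqxx.
by rewrite aE 1?ltnW // /b ltn_eqF.
Qed.

(** As [delta] is the leading coefficient [tau] of the recurrence, its
    vanishing would put [Q k.+1] in the span of polynomials of lower degree. *)
Lemma delta_neq0 k : (k < n)%N -> delta k.+1 != 0.
Proof.
move=> kn; have [<- _ _] := quasiseparable_generators kn.
apply/eqP => tau0; have [_ /(_ k.+1 kn)/=] := formQ.
rewrite tau0 scale0r sub0r => QE.
have := degQ kn; rewrite QE size_polyN => sQ.
have degQk : degree_graded k Q by apply: degree_gradedW degQ; exact: ltnW.
by have := size_graded_sum (a^~ k.+1) degQk; rewrite sQ ltnn.
Qed.

Variable Qhat : nat -> {poly F}.
Hypothesis assocQ : generalized_associated n tau a Qhat.

(** The part of the recurrence for [Qhat k.+1] that involves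
    [Qhat 0, ..., Qhat k.-1], divided by [delta (n - k.+1)]. The value
    [aux_coef (n - j).-1 (n - k.+1)] comes from the entry of [a] at the
    reflected position. *)
Definition hat_tail k : {poly F} :=
  \sum_(j < k)
    (gamma (n - j)%N / delta (n - j)%N * aux_coef (n - j).-1 (n - k.+1)%N)
      *: Qhat j.

(** Because [k.+1 < n], the value [tau 0], about which the quasiseparable
    recurrence says nothing, does not occur among the reflected indices. *)
Lemma associated_step k : (k.+1 < n)%N ->
  let m := (n - k.+1)%N in
  Qhat k.+1 = delta m *: ('X * Qhat k)
    + (delta m / delta m.+1 * theta m.+1) *: Qhat k
    + delta m *: hat_tail k.
Proof.
move=> kn m.
have kn' : (0 < k.+1 <= n.-1)%N by lia.
have mn : (m < n)%N by lia.
have m0 : (0 < m)%N by lia.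
have tauE i : (0 < i <= n)%N -> tau i = delta i.
  by case: i => // i ilt; have [] := quasiseparable_generators ilt.
have [_ /(_ _ kn')/= ->] := assocQ.
rewrite /assoc_tau -/m tauE ?m0 1?ltnW // -addrA; congr (_ + _).
rewrite big_ord_recr /= opprD [LHS]addrC -!scaleNr; congr (_ + _).
  rewrite /assoc_a -/m; have -> : (n - k)%N = m.+1 by lia.
  have [_ -> _] := quasiseparable_generators mn.
  by rewrite !tauE ?m0 1?ltnW // mulrN opprK.
rewrite /hat_tail scaler_sumr -sumrN; apply: eq_bigr => j _.
have jk := ltn_ord j.
rewrite scalerA -scaleNr /assoc_a -/m; congr (_ *: _).
have nj : (n - j)%N = (n - j).-1.+1 by lia.
rewrite nj; have njn : ((n - j).-1 < n)%N by lia.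
have [_ _ ->] := quasiseparable_generators njn; last by lia.
by rewrite !tauE //; [rewrite /=; ring | lia].
Qed.

(** Passing from [hat_tail k] to [hat_tail k.+1] lowers the second index of
    every [aux_coef] from [m.+1] to [m], which multiplies all the terms by one
    common ratio, and adds the diagonal term in [Qhat k]. *)
Lemma hat_tailS k : (k.+2 < n)%N ->
  let m := (n - k.+2)%N in
  beta m.+2 *: hat_tail k.+1 =
    (alpha m.+2 * beta m.+1) *: hat_tail k
    + (beta m.+1 * beta m.+2 * gamma m.+2 / delta m.+2) *: Qhat k.
Proof.
move=> kn m; rewrite /hat_tail -/m big_ord_recr /= scalerDr; congr (_ + _).
  rewrite !scaler_sumr; apply: eq_bigr => j _; have jk := ltn_ord j.
  rewrite !scalerA; congr (_ *: _).
  have -> : (n - k.+1)%N = m.+1 by lia.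
  rewrite mulrCA aux_coefSr; last by lia.
  by ring.
have -> : (n - k)%N = m.+2 by lia.
by rewrite scalerA /= aux_coef_diag; congr (_ *: _); ring.
Qed.

Hypothesis beta_neq0 : forall k, (0 < k <= n)%N -> beta k != 0.

Lemma associated_three_term k : (k.+2 < n)%N ->
  Qhat k.+2 =
    (hat_alpha n delta k.+2 *: 'X - (hat_delta n alpha beta delta theta k.+2)%:P)
      * Qhat k.+1
    - (hat_beta n alpha beta delta k.+2 *: 'X
       + (hat_gamma n alpha beta gamma delta theta k.+2)%:P)
      * Qhat k.
Proof.
move=> kn; rewrite /hat_alpha /hat_beta /hat_delta /hat_gamma /= addn1 addn2.
have := associated_step kn; have := associated_step (ltnW kn).
have := hat_tailS kn.
have -> : (n - k.+1)%N = (n - k.+2).+1 by lia.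
set m := (n - k.+2)%N => /= tailE step1 step2.
have b2 : beta m.+2 != 0 by apply: beta_neq0; lia.
have d1 : delta m.+1 != 0 by apply: delta_neq0; lia.
have d2 : delta m.+2 != 0 by apply: delta_neq0; lia.
(* The previous step determines its own tail. *)
have tail1 : hat_tail k = (delta m.+1)^-1 *: Qhat k.+1 - 'X * Qhat k
    - (theta m.+2 / delta m.+2) *: Qhat k.
  rewrite step1 !scalerDr !scalerA mulVf // !scale1r !mulrA mulVf // mul1r.
  by rewrite [_^-1 * _]mulrC; ring.
have tail2 : hat_tail k.+1 = (alpha m.+2 * beta m.+1 / beta m.+2) *: hat_tail k
    + (beta m.+1 * gamma m.+2 / delta m.+2) *: Qhat k.
  apply: (scalerI b2); rewrite tailE scalerDr !scalerA.
  by congr (_ *: _ + _ *: _); field.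
(* Cancelling [beta m.+2 / beta m.+2] inside the coefficient beforehand leaves
   an identity in which inverses can be treated as independent variables. *)
have gammaE : delta m / delta m.+2 * (beta m.+1 / beta m.+2)
      * (theta m.+2 * alpha m.+2 - beta m.+2 * gamma m.+2) =
    delta m / delta m.+2 * beta m.+1
      * (theta m.+2 * alpha m.+2 / beta m.+2 - gamma m.+2).
  by field; rewrite b2.
rewrite gammaE step2 tail2 tail1 -!mul_polyC.
ring.
Qed.

Lemma associated_first_step : (1 < n)%N ->
  Qhat 1%N =
    (hat_alpha n delta 1 *: 'X - (hat_delta n alpha beta delta theta 1)%:P)
      * Qhat 0%N.
Proof.
move=> n1; rewrite (associated_step n1) /hat_alpha /hat_delta /hat_tail.
rewrite big_ord0 scaler0 /= addn1 -!mul_polyC; ring.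
Qed.

End Quasiseparable.

Theorem lemma4p3 (R : realType) (n : nat)
    (Q G Qhat : nat -> {poly R[i]})
    (tau : nat -> R[i]) (a : nat -> nat -> R[i])
    (alpha beta gamma delta theta : nat -> R[i])
    (n_gt0 : (0 < n)%N)
    (degQ : degree_graded n Q)
    (formQ : recurrent_form n tau a Q)
    (qsQ : quasiseparable_recurrence n alpha beta gamma delta theta G Q)
    (beta_neq0 : forall k, (0 < k <= n)%N -> beta k != 0)
    (assocQ : generalized_associated n tau a Qhat) :
  ((1 < n)%N ->
    Qhat 1%N =
      (hat_alpha n delta 1 *: 'X - (hat_delta n alpha beta delta theta 1)%:P)
        * Qhat 0%N) /\
  (forall k, (2 <= k <= n.-1)%N ->
    Qhat k =
      (hat_alpha n delta k *: 'X - (hat_delta n alpha beta delta theta k)%:P)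
        * Qhat k.-1
      - (hat_beta n alpha beta delta k *: 'X
         + (hat_gamma n alpha beta gamma delta theta k)%:P)
        * Qhat k.-2).
Proof.
split=> [|k /andP[k2 kn]].
  exact: (associated_first_step qsQ degQ formQ assocQ).
case: k k2 kn => [|[|k]] // _ kn.
apply: (associated_three_term qsQ degQ formQ assocQ beta_neq0).
by lia.
Qed.
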